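(* Let $K_n$ be the complete graph with vertices $v_1,\dots,v_n$, and let $f:V(K_n)\to 2^{\mathbb{N}_0}$ be an integer additive set-indexer with $f(v_i)=A_i$, where each $A_i$ is a non-empty finite set. For each $i$ let $D_i=\{a-a' : a,a'\in A_i,\ a>a'\}$ be the difference set of $A_i$. Then $f$ is a strong integer additive set-indexer of $K_n$ if and only if the sets $D_1,D_2,\dots,D_n$ are pairwise disjoint.
   Context: All graphs are simple and finite. $\mathbb{N}_0$ is the set of non-negative integers and $2^{\mathbb{N}_0}$ its power set; all set-labels are non-empty finite sets. For sets $A,B$, $A+B=\{a+b: a\in A, b\in B\}$. An integer additive set-indexer (IASI) of a graph $G$ is an injective function $f:V(G)\to 2^{\mathbb{N}_0}$ such that the induced function $f^+:E(G)\to 2^{\mathbb{N}_0}$, $f^+(uv)=f(u)+f(v)$, is also injective. An IASI $f$ is strong if $|f^+(uv)|=|f(u)|\,|f(v)|$ for every edge $uv$. *)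

(* Defs.v *)
From HB Require Import structures.
From mathcomp Require Import all_boot finmap.

Set Implicit Arguments.
Unset Strict Implicit.
Unset Printing Implicit Defensive.

Local Open Scope fset_scope.

Record sgraph := SGraph {
  vertex :> finType;
  adj : rel vertex;
  adj_sym : symmetric adj;
  adj_irrefl : irreflexive adj
}.

Definition complete_adj (n : nat) : rel 'I_n := fun u v => u != v.

Lemma complete_adj_sym n : symmetric (@complete_adj n).
Proof. by move=> u v; rewrite /complete_adj eq_sym. Qed.

Lemma complete_adj_irrefl n : irreflexive (@complete_adj n).
Proof. by move=> u; rewrite /complete_adj eqxx. Qed.

Definition complete_graph (n : nat) : sgraph :=
  SGraph (@complete_adj_sym n) (@complete_adj_irrefl n).

Definition sumset (A B : {fset nat}) : {fset nat} :=
  [fset (a + b)%N | a in A, b in B].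

Definition diffset (A : {fset nat}) : {fset nat} :=
  [fset (a - a')%N | a in A, a' in [fset x in A | (x < a)%N]].

(* The induced labelling of an edge, given by its two endpoints; by
   [edge_labelC] it depends only on the unordered pair. *)
Definition edge_label (G : sgraph) (f : G -> {fset nat}) (u v : G) :
  {fset nat} := sumset (f u) (f v).

Lemma edge_labelC (G : sgraph) (f : G -> {fset nat}) (u v : G) :
  edge_label f u v = edge_label f v u.
Proof.
by apply/fsetP=> x; apply/imfset2P/imfset2P=> -[a Ha [b Hb ->]];
  exists b => //; exists a => //; rewrite addnC.
Qed.

(* An edge uv is the unordered pair [set u; v], so injectivity of the induced
   labelling is equality of these two-element sets. *)
Definition iasi (G : sgraph) (f : G -> {fset nat}) : Prop :=
  injective f /\
  forall u v x y : G, adj u v -> adj x y ->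
    edge_label f u v = edge_label f x y -> [set u; v]%SET = [set x; y]%SET.

Definition strong_iasi (G : sgraph) (f : G -> {fset nat}) : Prop :=
  iasi f /\
  forall u v : G, adj u v -> #|` edge_label f u v| = (#|` f u| * #|` f v|)%N.

(* Main.v *)
(** A coincidence [a + b = a' + b'] between distinct pairs with [a, a' \in A]
    and [b, b' \in B] amounts to [a - a' = b' - b], a nonzero common element
    (up to sign) of the two difference sets.  Hence addition is injective on
    [A * B], that is [#|A + B| = #|A| #|B|], exactly when the difference sets
    of [A] and [B] are disjoint; in a complete graph every pair of distinct
    vertices is an edge. *)

Require Import Defs.
From mathcomp Require Import all_boot finmap zify.

Local Open Scope fset_scope.

Lemma card_fsetM (K K' : choiceType) (A : {fset K}) (B : {fset K'}) :
  #|` A `*` B| = (#|` A| * #|` B|)%N.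
Proof.
rewrite /fsetM (perm_size (enum_imfset2 _ _)) /=.
  by rewrite size_allpairs.
by move=> [x y] [x' y'] _ _ /= [-> ->].
Qed.

(** As the image of one map on the product, the sumset has full cardinality exactly when that map is
    injective there. *)
Lemma sumsetE (A B : {fset nat}) :
  sumset A B = [fset (p.1 + p.2)%N | p in A `*` B].
Proof.
apply/fsetP=> x; apply/imfset2P/imfsetP => [[a aA [b bB ->]]|[[a b]]] /=.
  by exists (a, b); rewrite //= in_fsetM aA.
by rewrite in_fsetM /= => /andP[aA bB] ->; exists a => //; exists b.
Qed.

Lemma diffsetP (A : {fset nat}) (d : nat) :
  reflect (exists a a', [/\ a \in A, a' \in A, (a' < a)%N & d = (a - a')%N])
          (d \in diffset A).
Proof.
apply: (iffP (imfset2P _ _ _ _ _)) => [[a aA [a']]|[a [a' [aA a'A lt_a ->]]]].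
  by rewrite !inE /= => /andP[a'A lt_a] ->; exists a, a'.
by exists a => //; exists a'; rewrite // !inE a'A.
Qed.

Lemma mem_diffset (A : {fset nat}) (a a' : nat) :
  a \in A -> a' \in A -> (a' < a)%N -> (a - a')%N \in diffset A.
Proof. by move=> aA a'A lt_a; apply/diffsetP; exists a, a'. Qed.

Lemma card_sumset_eqP (A B : {fset nat}) :
  #|` sumset A B| = (#|` A| * #|` B|)%N <->
  [disjoint diffset A & diffset B].
Proof.
rewrite sumsetE -card_fsetM; split.
  move/eqP/card_in_imfsetP => inj_add; apply/fdisjointP => d.
  move=> /diffsetP[a [a' [aA a'A lt_a ->]]].
  apply/negP => /diffsetP[b [b' [bB b'B lt_b dE]]].
  (* By [dE], [a + b' = a' + b]: these two pairs have the same sum. *)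
  suff [aE _] : (a, b') = (a', b) by rewrite aE ltnn in lt_a.
  by apply: inj_add; rewrite ?in_fsetM /= ?aA ?a'A //; lia.
move=> /fdisjointP disAB; apply/eqP/card_in_imfsetP => -[a b] [a' b'].
rewrite !in_fsetM /= => /andP[aA bB] /andP[a'A b'B] sumE.
(* Subtraction on [nat] is truncated, so the order of [a] and [a'] decides which differences are the
   positive ones; [a = a'] forces [b = b']. *)
have [lt_a|lt_a|aE] := ltngtP a a'; last by congr (_, _); lia.
  have := disAB _ (mem_diffset _ _ _ a'A aA lt_a).
  have -> : (a' - a = b - b')%N by lia.
  by rewrite mem_diffset //; lia.
have := disAB _ (mem_diffset _ _ _ aA a'A lt_a).
have -> : (a - a' = b' - b)%N by lia.
by rewrite mem_diffset //; lia.
Qed.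

Theorem theorem1 (n : nat) (f : complete_graph n -> {fset nat})
    (f_nonempty : forall i : complete_graph n, f i != fset0)
    (f_iasi : iasi f) :
  strong_iasi f <->
  (forall i j : complete_graph n, i != j ->
     fdisjoint (diffset (f i)) (diffset (f j))).
Proof.
split=> [[_ strong] i j neq_ij | disj].
  exact/card_sumset_eqP/strong.
by split=> // u v adj_uv; apply/card_sumset_eqP/disj.
Qed.
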